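(* Let $p$ be a prime, let $\mathcal{F}_p\subseteq\mathbb{F}_p$ be the set of Fibonacci residues modulo $p$, let $\pi(p)$ be the Pisano number of $p$, and let $G\subset\mathbb{F}_p^*$ be a subgroup. Then $$|\mathcal{F}_p\cap G|<\max\left(6\sqrt[3]{2}\,(\pi(p))^{1/3} |G|^{1/3},\ \frac{12}{p}\pi(p)|G|\right).$$
   Context: $\mathbb{F}_p=\mathbb{Z}/p\mathbb{Z}$ and $\mathbb{F}_p^*$ is its multiplicative group. The Fibonacci sequence modulo $p$ is $f_{n+2}=f_{n+1}+f_n$, $f_0=0$, $f_1=1$ in $\mathbb{F}_p$. It is periodic; the Pisano number $\pi(p)$ is the length of its period. $\mathcal{F}_p$ is the set of values of this sequence in $\mathbb{F}_p$. *)

(* Defs.v *)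
From mathcomp Require Import all_boot all_order all_fingroup all_algebra.
From mathcomp Require Import boolp.

Set Implicit Arguments.
Unset Strict Implicit.
Unset Printing Implicit Defensive.

Import GRing.Theory.
Local Open Scope ring_scope.

(* Intended for prime p: for other p, 'F_p is the field with pdiv p elements
   (with 2 elements when p <= 1). *)
Fixpoint fibp (p n : nat) : 'F_p :=
  if n is n1.+1 then
    if n1 is n2.+1 then fibp p n1 + fibp p n2 else 1
  else 0.

Definition fib_residues (p : nat) : {set 'F_p} :=
  [set x | `[< exists n : nat, fibp p n = x >]].

Definition fib_period (p k : nat) : bool :=
  (0 < k)%N && `[< forall n : nat, fibp p (n + k)%N = fibp p n >].

(* Two consecutive residues determine the sequence in both directions, so a
   repeated pair among the finitely many pairs gives a pure period. *)
Lemma fib_period_ex (p : nat) : exists k : nat, fib_period p k.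
Proof.
pose g (n : nat) := (fibp p n, fibp p n.+1).
have fibpSS n : fibp p n.+2 = fibp p n.+1 + fibp p n by [].
have gP a b : g a = g b -> fibp p a = fibp p b /\ fibp p a.+1 = fibp p b.+1.
  by move=> e; split; [exact: (congr1 fst e) | exact: (congr1 snd e)].
have step a b : g a = g b -> g a.+1 = g b.+1.
  by case/gP => e0 e1; rewrite /g !fibpSS e0 e1.
have back a b : g a.+1 = g b.+1 -> g a = g b.
  by case/gP => e1; rewrite /g !fibpSS e1 => /addrI ->.
have [a [k k0 gk]] : exists a, exists2 k, (0 < k)%N & g (a + k)%N = g a.
  pose N := #|{: 'F_p * 'F_p}|.
  have : ~~ injectiveb (fun i : 'I_N.+1 => g i).
    apply/injectiveP => /leq_card; rewrite card_ord /N.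
    by rewrite ltnn.
  case/injectivePn => i [j nij gij].
  have [lt|lt|e] := ltngtP i j; last by case/eqP: nij; apply: val_inj.
    by exists i, (j - i)%N; rewrite ?subn_gt0 // subnKC // ltnW.
  by exists j, (i - j)%N; rewrite ?subn_gt0 // subnKC // ltnW.
have g0 : g k = g 0%N.
  by elim: a gk => [//|a IH]; rewrite addSn => /back.
exists k; rewrite /fib_period k0; apply/asboolP => n.
suff : g (n + k)%N = g n by case/gP.
by elim: n => [//|n IH]; rewrite addSn; apply: step.
Qed.

Definition pisano (p : nat) : nat := ex_minn (fib_period_ex p).

(* Main.v *)
Require Import Defs.
From mathcomp Require Import all_boot all_order all_fingroup all_algebra.
From mathcomp Require Import all_field cyclic.
From mathcomp Require Import boolp reals exp.
From mathcomp Require Import ring lra zify.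

(** Write N for the number of Fibonacci residues in G, P for the Pisano number
    and g for the order of G. If the bound fails then N ^ 3 >= 432 P g and
    N p >= 12 P g. Together with N <= g and N <= P this makes N large and
    p >= 12 N, so no small case has to be treated apart, and P = 2h is even.

    Let a, b be the roots of X ^ 2 - X - 1 in an extension K of the prime
    field. By Binet's formula (a - b) f_n = a ^ n - b ^ n, with ab = -1 and
    (a - b) ^ 2 = 5, the element w = (a / b) ^ n = (- a ^ 2) ^ n satisfies
      (w - 1) ^ 2 = 5 (-1) ^ n f_n ^ 2 w             (fib_golden_curve).
    Fix the parity of n, so that the sign is a constant e. If f_n lies in G,
    then w is a solution, other than 0 and 1, of the two equations
      w ^ h = e ^ h   and   (w - 1) ^ (2g) = (5e) ^ g w ^ g.
    The solution set W is closed under inversion; a residue x belongs to the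
    two solutions w and 1 / w, and a solution to at most two residues x, - x,
    so there are at most |W| + 2 residues of each parity (card_le_curve).

    The set W is counted by Stepanov's method (stepanov_bound). One takes a
    nonzero combination Phi of the polynomials
      X ^ k (X ^ h) ^ i (X - 1) ^ (2gj) X ^ (g (C - 1 - j)),
      k < A, i < B, j < C,
    vanishing to order M at every point of W. For the derivation
    D = X (X - 1) d/dX, which maps X ^ e (X - 1) ^ f to a polynomial multiple
    of itself, the two equations turn the values of D ^ m Phi on W into those
    of a polynomial with A + m coefficients, up to an invertible factor. These
    coefficients can all be made zero as soon as the sum of the A + m over
    m < M is less than A B C, and then M |W| is at most the degree of Phi. The
    polynomials above are linearly independent (monomial_free) because a
    nonzero polynomial of degree less than p with at most 2g terms cannot be
    divisible by (X - 1) ^ (2g) (fewnomial_eq0).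

    With A about N / 10, M = 2A, B about 2g / A and C about 4A / B the
    resulting bound for the two parities together is below 0.7 N, which is
    the contradiction (stepanov_parameters). *)

Set Implicit Arguments.
Unset Strict Implicit.
Unset Printing Implicit Defensive.
Import Order.TTheory GRing.Theory Num.Theory.
Local Open Scope ring_scope.

(** * The logarithmic derivation X (X - 1) d/dX *)

Section LogDerivation.
Variable K : fieldType.

Lemma dvdp_exp_XsubC_deriv (r : {poly K}) c n :
  ('X - c%:P) ^+ n.+1 %| r -> ('X - c%:P) ^+ n %| r^`().
Proof.
case/dvdpP => q ->; rewrite derivM deriv_exp derivXsubC mul1r /= -mulr_natr.
apply: dvdp_add; first by rewrite exprS mulrA dvdp_mulIr.
by rewrite mulrCA dvdp_mulIl.
Qed.

(** The factors X and X - 1 make every X ^ e (X - 1) ^ f divide its own image;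
    they are invertible away from 0 and 1, so iterating logder detects the
    order of vanishing there as differentiation does. *)
Definition logder (r : {poly K}) : {poly K} := 'X * ('X - 1%:P) * r^`().

(** The cofactor of X ^ e (X - 1) ^ f in its m-th logarithmic derivative, see
    iter_logder_monomial. Its degree is at most m whatever e and f are, which
    is why few linear conditions suffice to kill a derivative. *)
Fixpoint logder_coef (e f m : nat) : {poly K} :=
  if m is m1.+1 then
    let r := logder_coef e f m1 in
    logder r + (e%:R *: ('X - 1%:P) + f%:R *: 'X) * r
  else 1.

Lemma size_logder_coef e f m : (size (logder_coef e f m) <= m.+1)%N.
Proof.
elim: m => [|m IH] /=; first by rewrite size_poly1.
set r := logder_coef e f m in IH *.
have s1 : (size ('X - 1%:P : {poly K})%R <= 2)%N by rewrite size_XsubC.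
have s2 : (size (e%:R *: ('X - 1%:P) + f%:R *: 'X : {poly K})%R <= 2)%N.
  apply: leq_trans (size_polyD _ _) _; rewrite geq_max.
  by rewrite !(leq_trans (size_scale_leq _ _)) // size_polyX.
apply: leq_trans (size_polyD _ _) _; rewrite geq_max; apply/andP; split.
  rewrite /logder; have [r0|r0] := eqVneq r^`() 0.
    by rewrite r0 mulr0 size_poly0.
  have s3 := size_polyMleq ('X * ('X - 1%:P)) r^`().
  have s4 := size_polyMleq 'X ('X - 1%:P : {poly K}).
  have s5 : (size r^`() < m.+1)%N.
    apply: leq_trans IH; apply: lt_size_deriv.
    by apply: contraNneq r0 => ->; rewrite deriv0.
  rewrite size_polyX size_XsubC in s4; apply: leq_trans s3 _.
  move: s4 s5; move: (size _) (size _) => x y; lia.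
by apply: leq_trans (size_polyMleq _ _) _; lia.
Qed.

Lemma mul_deriv_exp_XsubC (c : K) n :
  ('X - c%:P) * (('X - c%:P) ^+ n)^`() = n%:R *: ('X - c%:P) ^+ n.
Proof.
rewrite deriv_exp derivXsubC mul1r scaler_nat mulrnAr.
by case: n => // n; rewrite -exprS.
Qed.

Lemma logder_monomial e f :
  logder ('X^e * ('X - 1%:P) ^+ f) =
  (e%:R *: ('X - 1%:P) + f%:R *: 'X) * ('X^e * ('X - 1%:P) ^+ f).
Proof.
have E := mul_deriv_exp_XsubC 0 e; have F := mul_deriv_exp_XsubC 1 f.
rewrite subr0 in E; move: E F; rewrite /logder derivM -!mul_polyC.
move: ('X^e)^`() (('X - 1%:P) ^+ f)^`() => E' F' E F.
rewrite mulrDr [X in X + _](_ : _ = ('X - 1%:P) * ('X * E') * ('X - 1%:P) ^+ f);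
  last by ring.
rewrite E [X in _ + X](_ : _ = 'X * 'X^e * (('X - 1%:P) * F')); last by ring.
by rewrite F; ring.
Qed.

Lemma iter_logder_monomial e f m :
  iter m logder ('X^e * ('X - 1%:P) ^+ f) =
  logder_coef e f m * ('X^e * ('X - 1%:P) ^+ f).
Proof.
elim: m => [|m IH]; first by rewrite mul1r.
rewrite iterS IH /=; set r := logder_coef e f m.
rewrite {1}/logder derivM mulrDr mulrDl (mulrCA _ r) -/(logder _).
by rewrite logder_monomial mulrA; congr (_ + _); rewrite mulrCA mulrA.
Qed.

Lemma iter_logder_sum (T : finType) (a : T -> K) (F : T -> {poly K}) m :
  iter m logder (\sum_t a t *: F t) = \sum_t a t *: iter m logder (F t).
Proof.
elim: m => // m IH; rewrite iterS IH /logder raddf_sum mulr_sumr.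
by apply: eq_bigr => t _; rewrite /= derivZ scalerAr.
Qed.

End LogDerivation.

Arguments logder {K} r.

(** * Vanishing orders in characteristic p *)

Section PolyPrimeChar.
Variables (K : fieldType) (p : nat).
Hypothesis pK : p \in [pchar K].

Lemma natr_inj_lt_pchar m n :
  (m < p)%N -> (n < p)%N -> m%:R = n%:R :> K -> m = n.
Proof.
wlog le_mn : m n / (m <= n)%N => [H mp np e | mp np /eqP].
  by case/orP: (leq_total m n) => le; [exact: H | apply/esym/H].
rewrite eq_sym -subr_eq0 -natrB // -(dvdn_pcharf pK) => dv.
apply/eqP; rewrite eqn_leq le_mn -subn_eq0 /=; case: posnP => // lt0.
by have := dvdn_leq lt0 dv; lia.
Qed.

(** The derivative of (X - c) ^ m q with q nonzero at c has the leading factor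
    m, and so vanishes at c to order exactly m - 1 when 0 < m < p. *)
Lemma dvdp_exp_XsubC_of_deriv (r : {poly K}) c n : (n < p)%N ->
  root r c -> ('X - c%:P) ^+ n %| r^`() -> ('X - c%:P) ^+ n.+1 %| r.
Proof.
move=> np rc dv; have [->|r0] := eqVneq r 0; first exact: dvdp0.
have [m [q]] := multiplicity_XsubC r c; rewrite r0 /= => qc Er.
have [lenm|] := ltnP n m; first by rewrite Er dvdp_mull // dvdp_exp2l.
case: m Er => [|m] Er lemn.
  by case/negP: qc; move: rc; rewrite Er expr0 mulr1.
have Xc0 : ('X - c%:P) ^+ m != 0 by rewrite expf_neq0 // polyXsubC_eq0.
have : ('X - c%:P) ^+ m.+1 %| r^`() by rewrite (dvdp_trans _ dv) ?dvdp_exp2l.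
rewrite Er derivM deriv_exp derivXsubC mul1r /= dvdp_addr ?dvdp_mulIr //.
rewrite -mulr_natr mulrCA [X in X %| _]exprS mulrC dvdp_mul2l //.
rewrite -root_factor_theorem rootM (negPf qc) /= -polyC_natr rootC => /eqP m0.
have lt_mp := leq_ltn_trans lemn np.
by have := natr_inj_lt_pchar lt_mp (leq_ltn_trans (leq0n _) lt_mp) m0.
Qed.

(** Induction on the number of terms: X f' - e0 f has lost the term of exponent
    e0, has the other coefficients multiplied by e - e0, nonzero modulo p, and
    its order of vanishing at 1 is smaller by at most one. *)
Lemma fewnomial_eq0 (s : seq nat) (f : {poly K}) :
  all (fun e => e < p)%N s -> (forall e, f`_e != 0 -> e \in s) ->
  ('X - 1%:P) ^+ size s %| f -> f = 0.
Proof.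
elim: s f => [|e0 s IH] f /=.
  move=> _ f0 _; apply/polyP => e; rewrite coef0; apply/eqP.
  by case: eqVneq => // /f0.
case/andP=> e0p sp fs dv.
have /polyP f0 : 'X * f^`() - e0%:R *: f = 0.
  apply: IH => // [e|].
    rewrite coefB coefZ coefXM coef_deriv => nz.
    have /fs : f`_e != 0.
      apply: contraNneq nz; case: (e) => [|e1] /= ->;
        by rewrite ?mul0rn mulr0 subrr.
    rewrite inE => /predU1P[] // ee0; case/eqP: nz.
    by rewrite ee0; case: (e0) => [|e1] /=; rewrite mulr_natl subrr.
  apply: dvdp_sub; first exact/dvdp_mull/dvdp_exp_XsubC_deriv.
  by rewrite -mul_polyC dvdp_mull // (dvdp_trans _ dv) // dvdp_exp2l.
have fE : f = f`_e0 *: 'X^e0.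
  apply/polyP => e; rewrite coefZ coefXn; have [->|ne] := eqVneq e e0.
    by rewrite mulr1.
  rewrite mulr0; apply/eqP; apply: contraNT ne => fe0.
  have ep : (e < p)%N.
    by have /fs := fe0; rewrite inE => /predU1P[-> // | /(allP sp)].
  apply/eqP/natr_inj_lt_pchar => //; apply/eqP; rewrite -subr_eq0.
  have := f0 e; rewrite coefB coefZ coefXM coef_deriv coef0.
  move=> H; have {}H : f`_e * (e%:R - e0%:R) = 0.
    by rewrite -[RHS]H mulrBr; case: (e) => [|e1] /=; ring.
  by move/eqP: H; rewrite mulf_eq0 (negPf fe0).
have : root f 1.
  by rewrite root_factor_theorem (dvdp_trans _ dv) // exprS dvdp_mulIl.
by rewrite fE rootE hornerZ hornerXn expr1n mulr1 => /eqP->; rewrite scale0r.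
Qed.

Lemma dvdp_exp_XsubC_logder (r : {poly K}) w n : (n <= p)%N ->
  w != 0 -> w != 1 -> (forall m, (m < n)%N -> root (iter m logder r) w) ->
  ('X - w%:P) ^+ n %| r.
Proof.
move=> + w0 w1; elim: n r => [|n IH] r np rw; first by rewrite expr0 dvd1p.
apply: dvdp_exp_XsubC_of_deriv => //; first exact: (rw 0%N).
have : ('X - w%:P) ^+ n %| logder r.
  apply: IH => [|m mn]; first exact: ltnW.
  by rewrite -iterSr; apply: rw.
rewrite Gauss_dvdpr // coprimep_expl // coprimep_sym coprimep_XsubC.
by rewrite rootM rootX root_XsubC negb_or w0.
Qed.

End PolyPrimeChar.

(** * Stepanov's method *)

Lemma nontrivial_relation (K : fieldType) (T : finType)
    (E : seq {ffun T -> K}) : (size E < #|T|)%N ->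
  exists2 a : T -> K, (exists t, a t != 0) &
    forall L, L \in E -> \sum_t a t * L t = 0.
Proof.
move=> ltE; pose A := \matrix_(i < #|T|, j < size E) E`_j (enum_val i).
have : kermx A != 0.
  rewrite kermx_eq0 /row_free neq_ltn (leq_ltn_trans _ ltE) //.
  exact: rank_leq_col.
case/rowV0Pn => u /sub_kermxP uA0 /rV0Pn[i ui].
exists (fun t => u 0 (enum_rank t)).
  by exists (enum_val i); rewrite enum_valK.
move=> L LE; have ltj := LE; rewrite -index_mem in ltj.
move/rowP/(_ (Ordinal ltj)): uA0; rewrite !mxE => uL.
rewrite -[RHS]uL (reindex_onto enum_val enum_rank) => [|t _];
  last exact: enum_rankK.
apply: eq_big => [k|k _]; first by rewrite enum_valK eqxx.
by rewrite enum_valK mxE /= nth_index.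
Qed.

Lemma nontrivial_poly_relation (K : fieldType) (T : finType) n (D : nat -> nat)
    (P : nat -> T -> {poly K}) :
  (forall m t, (size (P m t) <= D m)%N) -> (\sum_(m < n) D m < #|T|)%N ->
  exists2 a : T -> K, (exists t, a t != 0) &
    forall m, (m < n)%N -> \sum_t a t *: P m t = 0.
Proof.
move=> sP ltD.
pose E := [seq [ffun t => (P m t)`_l] | m <- iota 0 n, l <- iota 0 (D m)].
have /nontrivial_relation[a a0 aE] : (size E < #|T|)%N.
  rewrite size_allpairs_dep.
  rewrite (_ : map _ _ = map D (iota 0 n)) ?sumnE ?big_map; last first.
    by apply: eq_map => m; rewrite size_iota.
  by move: ltD; rewrite -(big_mkord xpredT D) /index_iota subn0.
exists a => // m ltmn; apply/polyP => l; rewrite coef0 coef_sum.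
have [ltlD|leDl] := ltnP l (D m); last first.
  rewrite big1 // => t _.
  by rewrite coefZ nth_default ?mulr0 // (leq_trans (sP m t)).
have /aE aEl : [ffun t => (P m t)`_l] \in E.
  by apply: allpairs_f_dep; rewrite mem_iota.
by rewrite -[RHS]aEl; apply: eq_bigr => t _; rewrite coefZ ffunE.
Qed.

(** Reducing a vanishing d-adic sum modulo d kills its digits one by one, from
    the lowest on, provided that no nonzero digit is a multiple of d. *)
Lemma sum_exp_eq0 (K : fieldType) (d : {poly K}) n (r : nat -> {poly K}) :
  d != 0 ->
  (forall j, (j < n)%N -> d %| r j -> r j = 0) ->
  \sum_(j < n) d ^+ j * r j = 0 -> forall j, (j < n)%N -> r j = 0.
Proof.
move=> d0; elim: n r => // n IH r rP; rewrite big_ord_recl expr0 mul1r.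
have -> : \sum_(i < n) d ^+ lift ord0 i * r (lift ord0 i) =
          d * \sum_(i < n) d ^+ i * r i.+1.
  by rewrite mulr_sumr; apply: eq_bigr => i _; rewrite lift0 exprS mulrA.
move=> S0; have r0 : r 0%N = 0.
  apply: rP => //; move/eqP: S0; rewrite addr_eq0 => /eqP->.
  by rewrite dvdpNr dvdp_mulIl.
move: S0; rewrite r0 add0r => /eqP; rewrite mulf_eq0 (negPf d0) /= => /eqP S0.
case=> // j; apply: (IH (fun j => r j.+1)) => // i lt_in; exact: rP.
Qed.

Section Stepanov.
Variables (K : fieldType) (p : nat).
Hypothesis pK : p \in [pchar K].
Variables (h g A B C : nat).
Hypotheses (A_le_h : (A <= h)%N) (AB_le : (A * B <= 2 * g)%N).
Hypothesis expo_lt : (A + h * B.-1 <= p)%N.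

Definition stepanov_index : finType := ('I_C * ('I_A * 'I_B))%type.
Local Notation T := stepanov_index.

Definition expX (t : T) := (t.2.1 + h * t.2.2 + g * (C.-1 - t.1))%N.
Definition expX1 (t : T) := (2 * g * t.1)%N.

(** For t = (j, (k, i)) this is X ^ k (X ^ h) ^ i ((X - 1) ^ 2 / X) ^ (g j),
    multiplied by X ^ (g (C - 1)) to make it a polynomial for every j < C. *)
Definition monomial t : {poly K} := 'X^(expX t) * ('X - 1%:P) ^+ expX1 t.

(** A relation is a (X - 1) ^ (2g)-adic expansion whose j-th digit is a power of
    X times q j. Since q j has A B <= 2g terms and degree less than p, it is
    not a nonzero multiple of (X - 1) ^ (2g). *)
Lemma monomial_free (a : T -> K) :
  \sum_t a t *: monomial t = 0 -> forall t, a t = 0.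
Proof.
pose q (j : 'I_C) : {poly K} := \sum_s a (j, s) *: 'X^(s.1 + h * s.2).
pose r j : {poly K} :=
  if insub j is Some j' then 'X^(g * (C.-1 - j)) * q j' else 0.
have d0 : ('X - 1%:P) ^+ (2 * g) != 0 :> {poly K}.
  by rewrite expf_neq0 // polyXsubC_eq0.
have qP j : ('X - 1%:P) ^+ (2 * g) %| q j -> q j = 0.
  pose s := [seq (k + h * i)%N | k <- iota 0 A, i <- iota 0 B].
  move=> dv; apply: (fewnomial_eq0 pK (s := s)).
  - apply/allP => e /allpairsP[[k i]] /=; rewrite !mem_iota => -[lk li ->].
    by nia.
  - move=> e; apply: contraR => /negP es.
    rewrite coef_sum big1 // => -[k i] _ /=.
    rewrite coefZ coefXn; case: eqP => [E|_]; last by rewrite mulr0.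
    by case: es; rewrite E; apply: allpairs_f; rewrite mem_iota /=.
  apply: dvdp_trans dv; apply: dvdp_exp2l.
  by rewrite size_allpairs !size_iota.
have q_coef (j : 'I_C) (s : 'I_A * 'I_B) : (q j)`_(s.1 + h * s.2) = a (j, s).
  rewrite coef_sum (bigD1 s) //= coefZ coefXn eqxx mulr1.
  rewrite big1 ?addr0 // => u nus.
  rewrite coefZ coefXn; case: eqP => [E|_]; last by rewrite mulr0.
  case/negP: nus; case: s u E => [k i] [k' i'] /= E.
  (* As A <= h, the pair (k, i) is determined by k + h i. *)
  have lk := leq_trans (ltn_ord k) A_le_h.
  have lk' := leq_trans (ltn_ord k') A_le_h.
  have ei : i' = i :> nat by nia.
  by apply/eqP; congr pair; apply: val_inj => //=; nia.
move=> S0 [j s]; rewrite -q_coef; suff -> : q j = 0 by rewrite coef0.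
have rP i : (i < C)%N -> ('X - 1%:P) ^+ (2 * g) %| r i -> r i = 0.
  rewrite /r => lti; case: insubP => [i' _ _|_ _ //].
  rewrite Gauss_dvdpr; first by move/qP->; rewrite mulr0.
  rewrite coprimep_expl // coprimep_expr // coprimep_sym coprimep_XsubC.
  by rewrite rootX oner_eq0.
have /(_ j (ltn_ord j)) : forall i, (i < C)%N -> r i = 0.
  apply: sum_exp_eq0 d0 rP _; rewrite -[RHS]S0.
  rewrite (eq_bigr (fun t => a (t.1, t.2) *: monomial (t.1, t.2))) => [|[]//].
  rewrite -(pair_bigA _ (fun i s => a (i, s) *: monomial (i, s))) /=.
  apply: eq_bigr => i _; rewrite /r insubT //= => lti; rewrite /q !mulr_sumr.
  apply: eq_bigr => u _; rewrite -!scalerAr.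
  congr (a (_, _) *: _); first exact: val_inj.
  rewrite /monomial /expX /expX1 /= [in RHS]exprM [in RHS]exprD.
  by rewrite mulrA mulrC [in RHS]mulrC mulrCA mulrA.
rewrite /r valK => /eqP; rewrite mulf_eq0 expf_eq0 polyX_eq0 andbF /=.
by move/eqP.
Qed.

Lemma size_monomial t :
  (size (monomial t) <= (A.-1 + h * B.-1 + 2 * g * C.-1).+1)%N.
Proof.
rewrite size_monicM ?monicXn ?monic_neq0 ?monic_exp ?monicXsubC //.
rewrite size_polyXn size_exp_XsubC /expX /expX1 /=.
case: t => [[j ltj] [[k ltk] [i lti]]] /=; nia.
Qed.

(** The sum over m < M counts the coefficients to be killed: on the solutions
    the m-th logarithmic derivative of a combination of the monomials agrees,
    up to the factor w ^ (g (C - 1)), with a polynomial of size A + m. *)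
Theorem stepanov_bound M (de et : K) (s : seq K) : (M <= p)%N ->
  (\sum_(m < M) (A + m) < A * B * C)%N -> uniq s ->
  (forall w, w \in s ->
     [/\ w != 0, w != 1, w ^+ h = de & (w - 1) ^+ (2 * g) = et * w ^+ g]) ->
  (M * size s <= A.-1 + h * B.-1 + 2 * g * C.-1)%N.
Proof.
move=> Mp count us sP.
pose P m (t : T) : {poly K} :=
  logder_coef K (expX t) (expX1 t) m *
  ((de ^+ t.2.2 * et ^+ t.1) *: 'X^(t.2.1)).
have sizeP m t : (size (P m t) <= A + m)%N.
  apply: leq_trans (size_polyMleq _ _) _.
  have := size_logder_coef K (expX t) (expX1 t) m.
  have := size_scale_leq (de ^+ t.2.2 * et ^+ t.1) 'X^(t.2.1).
  rewrite size_polyXn.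
  by move: (ltn_ord t.2.1) (size _) (size _); lia.
have [|a [t0 at0] aP] :=
  @nontrivial_poly_relation K T M (fun m => A + m)%N P sizeP.
  by rewrite !card_prod !card_ord mulnC.
pose Phi := \sum_t a t *: monomial t.
have Phi0 : Phi != 0 by apply: contraNneq at0 => /monomial_free->.
have dvPhi w : w \in s -> ('X - w%:P) ^+ M %| Phi.
  move=> /sP[w0 w1 wh wg]; apply: (dvdp_exp_XsubC_logder pK Mp w0 w1) => m ltm.
  rewrite iter_logder_sum rootE horner_sum.
  have := congr1 (fun r : {poly K} => w ^+ (g * C.-1) * r.[w]) (aP m ltm).
  rewrite horner0 mulr0 horner_sum mulr_sumr => rel0.
  apply/eqP; rewrite -[RHS]rel0; apply: eq_bigr => t _.
  rewrite iter_logder_monomial !(hornerZ, hornerM, hornerXn).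
  rewrite horner_exp hornerXsubC /expX /expX1 (exprM _ (2 * g)%N) wg.
  rewrite exprMn -exprM !exprD (exprM _ h) wh.
  have -> : (g * C.-1 = g * (C.-1 - t.1) + g * t.1)%N.
    rewrite -mulnDr subnK // -ltnS.
    exact: leq_trans (ltn_ord _) (leqSpred _).
  by rewrite exprD; ring.
have dv : \prod_(w <- s) ('X - w%:P) ^+ M %| Phi.
  elim: (s) us dvPhi => [|w s' IH] /=; first by rewrite big_nil dvd1p.
  case/andP=> ws us dvP; rewrite big_cons Gauss_dvdp ?dvP ?mem_head //=.
    by apply: IH => // v vs; rewrite dvP // inE vs orbT.
  rewrite prodrXl coprimep_expl // coprimep_expr // coprimep_sym.
  by rewrite coprimep_XsubC root_prod_XsubC.
have szQ : size (\prod_(w <- s) ('X - w%:P) ^+ M) = (M * size s).+1.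
  have mQ : (\prod_(w <- s) ('X - w%:P)) ^+ M \is monic.
    by rewrite monic_exp // monic_prod_XsubC.
  rewrite prodrXl -[LHS]prednK ?size_poly_gt0 ?monic_neq0 //.
  by rewrite size_exp size_prod_XsubC mulnC.
have := dvdp_leq Phi0 dv; rewrite szQ => lt.
rewrite -ltnS; apply: leq_trans lt _.
apply: leq_trans (size_sum _ _ _) _; apply/bigmax_leqP => t _.
exact: leq_trans (size_scale_leq _ _) (size_monomial t).
Qed.

End Stepanov.

(** * Choice of the parameters *)

(** Both conclusions come from N ^ 2 <= P g and a cancellation. *)
Lemma large_of_cube_bound (N p g P : nat) :
  (0 < g)%N -> (0 < P)%N -> (N <= g)%N -> (N <= P)%N ->
  (432 * (P * g) <= N ^ 3)%N -> (12 * (P * g) <= N * p)%N ->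
  (432 <= N)%N /\ (12 * N <= p)%N.
Proof.
move=> g0 P0 Ng NP cube lin.
have NN : (N * N <= P * g)%N by rewrite leq_mul.
have N0 : (0 < N)%N by move: cube; case: N {Ng NP lin NN} => //; nia.
split; last first.
  have : (12 * N * N <= p * N)%N by lia.
  by rewrite leq_pmul2r.
have : (432 * (N * N) <= N * (N * N))%N by lia.
by rewrite leq_pmul2r // muln_gt0 N0.
Qed.

(** With k about N / 10, A = k and M = 2k, the value B = 2g / k is the largest
    one allowed by A B <= 2g, and B C >= 4k is what the count of coefficients
    requires, since the sum of the A + m is 2k ^ 2 + k (2k - 1) < 4k ^ 2. Up to
    rounding, the three parts of the degree, multiplied by 2 / M = 1 / k, are
    then at most 1, 864 h g / (432 k ^ 2) <= 0.25 N and 4k <= 0.4 N. *)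
Lemma stepanov_parameters (N p g h : nat) :
  (432 <= N)%N -> (12 * N <= p)%N -> (N <= 2 * h)%N -> (N <= g)%N ->
  (864 * (h * g) <= N ^ 3)%N -> (24 * (h * g) <= N * p)%N ->
  exists A B C M, [/\ (A <= h)%N, (A * B <= 2 * g)%N,
    (A + h * B.-1 <= p)%N, (M <= p)%N & [/\
    (\sum_(m < M) (A + m) < A * B * C)%N &
    (2 * (A.-1 + h * B.-1 + 2 * g * C.-1) + 4 * M < M * N)%N]].
Proof.
move=> N432 Np Nh Ng cube lin.
set k := (N %/ 10)%N; set B := (2 * g %/ k)%N; set q := (4 * k %/ B)%N.
have k1 : (10 * k <= N)%N by lia.
have k2 : (N <= 10 * k + 9)%N by lia.
have k43 : (43 <= k)%N by lia.
have Bk1 : (k * B <= 2 * g)%N.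
  by have := leq_trunc_div (2 * g) k; rewrite -/B; lia.
have Bk2 : (2 * g < k * (B + 1))%N.
  by have := @ltn_ceil (2 * g) k; rewrite -/B; lia.
have B20 : (20 <= B)%N by rewrite leq_divRL; lia.
have q1 : (B * q <= 4 * k)%N.
  by have := leq_trunc_div (4 * k) B; rewrite -/q; lia.
have q2 : (4 * k < B * (q + 1))%N.
  by have := @ltn_ceil (4 * k) B; rewrite -/q; lia.
have q5 : (5 * q <= k)%N by have := leq_mul B20 (leqnn q); lia.
have hB : (k * (h * B) <= 2 * (h * g))%N.
  by have := leq_mul Bk1 (leqnn h); lia.
(* C = q + 1, so that B * C > 4 * k while C.-1 <= 4 * k / B. *)
exists k, B, q.+1, (2 * k)%N; split; [lia | by [] | | lia | split].
- (* From k >= 43, N <= 10 * k + 9 <= 429 / 42 * k. *)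
  have : (k * (h * B) * 12 <= N * p)%N by lia.
  have : (N * p * 42 <= k * 429 * p)%N by rewrite mulnAC leq_mul2r; lia.
  move=> e1 e2; have e3 : (k * (h * B * 12 * 42) <= k * (429 * p))%N by lia.
  rewrite leq_pmul2l in e3; last by lia.
  have : (h * B.-1 <= h * B)%N by rewrite leq_mul2l leq_pred orbT.
  by lia.
- rewrite big_split /= sum_nat_const card_ord -(big_mkord xpredT id) bin2_sum.
  have binle : ('C(2 * k, 2) <= 2 * (k * k))%N.
    rewrite bin2; have : ((2 * k) * (2 * k).-1 <= 2 * k * (2 * k))%N.
      by rewrite leq_mul2l leq_pred orbT.
    by lia.
  have kBq : (k * (4 * k) < k * (B * (q + 1)))%N by rewrite ltn_pmul2l //; lia.
  by lia.
- have e1 : (2 * g * q <= k * (B * q + q))%N.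
    by have := leq_mul (ltnW Bk2) (leqnn q); lia.
  have e2 : (5 * (2 * g * q) <= k * 21 * k)%N.
    have := leq_mul (leqnn k) q1; have := leq_mul (leqnn k) q5; lia.
  have e3 : (h * B.-1 <= h * B)%N by rewrite leq_mul2l leq_pred orbT.
  have e4 : (432 * (k * (h * B)) <= N ^ 3)%N by lia.
  have e5 : (42 * N <= 429 * k)%N by lia.
  have e6 : (4 * N ^ 3 <= 432 * (N * (k * k)))%N.
    have : ((42 * N) * (42 * N) <= (429 * k) * (429 * k))%N by rewrite leq_mul.
    move=> e; have : ((N * N) * 4 <= 432 * (k * k))%N by lia.
    by move=> e'; have := leq_mul (leqnn N) e'; rewrite !expnS expn0; lia.
  have e7 : (4 * (k * (h * B)) <= k * (N * k))%N by lia.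
  have e8 : (4 * (h * B) <= N * k)%N.
    by move: e7; rewrite mulnCA leq_pmul2l; lia.
  have e9 : (10 * (k * k) <= N * k)%N by rewrite mulnA leq_mul2r k1 orbT.
  have e10 : (43 * k <= k * k)%N by rewrite leq_mul2r k43 orbT.
  by rewrite [q.+1.-1]/=; lia.
Qed.

(** * Binet's formula and the curve of Fibonacci residues *)

Lemma golden_field (F : finFieldType) :
  exists (K : finFieldType) (iota : {rmorphism F -> K}) (a : K), a ^+ 2 = a + 1.
Proof.
pose P : {poly F} := 'X^2 - 'X - 1.
have sP : size P = 3.
  by rewrite /P -addrA size_polyDl ?size_polyXn // -opprD size_polyN size_XaddC.
have P0 : P != 0 by rewrite -size_poly_gt0 sP.
have [L [rs Prs _]] := FinSplittingFieldFor P0.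
exists (finvect_type L), (GRing.in_alg L : {rmorphism F -> finvect_type L}).
have := eqp_size Prs; rewrite size_map_poly sP size_prod_XsubC.
case: rs Prs => [|a rs] Prs // _; exists a.
have : root (map_poly (GRing.in_alg L) P) a.
  by rewrite (eqp_root Prs) root_prod_XsubC mem_head.
rewrite rootE !rmorphB /= map_polyXn map_polyX rmorph1 !hornerE.
by rewrite -addrA -opprD subr_eq0 => /eqP.
Qed.

Section Golden.
Variables (p : nat) (K : fieldType) (iota : {rmorphism 'F_p -> K}) (a : K).
Hypothesis a2 : a ^+ 2 = a + 1.
Local Notation b := (1 - a).

Lemma golden_mul_conj : a * b = -1.
Proof. by rewrite mulrBr mulr1 -expr2 a2; ring. Qed.

Lemma golden_sub_sq : (a - b) ^+ 2 = 5%:R.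
Proof.
have -> : (a - b) ^+ 2 = 4%:R * (a ^+ 2 - a) + 1 by ring.
by rewrite a2; ring.
Qed.

Lemma golden_sub_neq0 : 5%:R != 0 :> K -> a - b != 0.
Proof. by apply: contraNneq => ab0; rewrite -golden_sub_sq ab0 expr0n. Qed.

Lemma binet n : iota (fibp p n) * (a - b) = a ^+ n - b ^+ n.
Proof.
suff : iota (fibp p n) * (a - b) = a ^+ n - b ^+ n /\
       iota (fibp p n.+1) * (a - b) = a ^+ n.+1 - b ^+ n.+1 by case.
elim: n => [|n [IH1 IH2]].
  by rewrite /= rmorph0 rmorph1 mul0r subrr mul1r.
split=> //; rewrite (_ : fibp p n.+2 = fibp p n.+1 + fibp p n) //.
rewrite rmorphD mulrDl.
have b2 : b ^+ 2 = b + 1.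
  have -> : b ^+ 2 = a ^+ 2 + 1 - a - a by ring.
  by rewrite a2; ring.
by rewrite IH1 IH2 -[n.+2]addn2 !exprD a2 b2 !exprS; ring.
Qed.

(** Over a period k, Binet's formula at k and k + 1 gives a ^ k = b ^ k and
    a ^ k (a - b) = a - b. *)
Lemma fib_period_golden k :
  a - b != 0 -> fib_period p k -> a ^+ k = 1 /\ b ^+ k = 1.
Proof.
move=> ab0 /andP[_ /asboolP per].
have := binet k; rewrite -[k]add0n per /= rmorph0 mul0r add0n => /esym/eqP.
rewrite subr_eq0 => /eqP eab.
have := binet k.+1.
rewrite -[k.+1]add1n per /= rmorph1 add1n !exprS -eab -mulrBl.
by rewrite mul1r -[LHS]mulr1 => /(mulfI ab0) <-.
Qed.

(** As a b = -1, the element w is (a / b) ^ n, and w - 2 + 1 / w equals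
    (a ^ n - b ^ n) ^ 2 / (a b) ^ n. *)
Lemma fib_golden_curve n (w := (- a ^+ 2) ^+ n) :
  (w - 1) ^+ 2 = 5%:R * (-1) ^+ n * iota (fibp p n) ^+ 2 * w.
Proof.
have e : a ^+ n * b ^+ n = (-1) ^+ n by rewrite -exprMn golden_mul_conj.
have wE : w = (-1) ^+ n * (a ^+ n) ^+ 2 by rewrite /w [LHS]exprNn exprAC.
rewrite -golden_sub_sq.
have -> : (a - b) ^+ 2 * (-1) ^+ n * iota (fibp p n) ^+ 2 * w =
  (iota (fibp p n) * (a - b)) ^+ 2 * ((-1) ^+ n * w) by ring.
have s2 : (-1) ^+ n * (-1) ^+ n = 1 :> K.
  by rewrite -exprD addnn -mul2n exprM sqrrN !expr1n.
rewrite binet wE mulrA s2 mul1r -exprMn mulrBl -expr2 [b ^+ n * _]mulrC e.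
rewrite (_ : (-1) ^+ n * (a ^+ n) ^+ 2 - 1 =
             (-1) ^+ n * ((a ^+ n) ^+ 2 - (-1) ^+ n)).
  by rewrite exprMn expr2 s2 mul1r.
by rewrite mulrBr s2.
Qed.

End Golden.

(** Double counting of the pairs (x, w) on the curve: an x lies on it with both
    w and 1 / w, and a w with at most two opposite values of x. The 2 accounts
    for the x with w = -1, the only value of w other than 1 equal to its
    inverse. *)
Lemma card_le_curve (F K : finFieldType) (iota : {rmorphism F -> K}) (c : K)
    (X : {set F}) (W : {set K}) : c != 0 -> 0 \notin W -> 1 \notin W ->
  (forall x, x \in X -> exists w, [/\ w \in W, w^-1 \in W &
     (w - 1) ^+ 2 = c * iota x ^+ 2 * w]) ->
  (#|X| <= #|W| + 2)%N.
Proof.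
move=> c0 W0 W1 XW; pose r x w := (w - 1) ^+ 2 == c * iota x ^+ 2 * w.
have fibre w (Y : {set F}) : w != 0 -> {in Y, forall x, r x w} -> (#|Y| <= 2)%N.
  move=> w0 Yr; have [->|[x0 x0Y]] := set_0Vmem Y; first by rewrite cards0.
  apply: (@leq_trans #|[set x0; - x0]|); last by rewrite cards2 ltnS leq_b1.
  apply/subset_leq_card/subsetP => x xY; rewrite !inE -eqf_sqr.
  have := Yr x xY; rewrite /r (eqP (Yr x0 x0Y)).
  rewrite (inj_eq (mulIf w0)) (inj_eq (mulfI c0)) -!rmorphXn.
  by rewrite (inj_eq (fmorph_inj iota)) eq_sym.
rewrite -(cardsID [set x | r x (-1)] X) addnC leq_add //; last first.
  apply: (@fibre (-1)) => [|x]; first by rewrite oppr_eq0 oner_eq0.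
  by rewrite !inE => /andP[].
set Y := X :\: _; rewrite -(leq_pmul2l (m := 2)) //.
have -> : (2 * #|Y| = \sum_(x in Y) 2)%N by rewrite sum_nat_const mulnC.
have -> : (2 * #|W| = \sum_(w in W) 2)%N by rewrite sum_nat_const mulnC.
apply: (@leq_trans (\sum_(x in Y) \sum_(w in W | r x w) 1)).
  apply: leq_sum => x; rewrite !inE => /andP[rx /XW[w [wW wVW rw]]].
  have w0 : w != 0 by apply: contraNneq W0 => <-.
  have w1 : w != 1 by apply: contraNneq W1 => <-.
  have wV : w != w^-1.
    rewrite -subr_eq0 -(inj_eq (mulIf w0)) mul0r mulrBl mulVf // -expr2.
    rewrite subr_sqr_1 mulf_eq0 subr_eq0 (negPf w1) addr_eq0.
    by apply: contraNneq rx => <-; apply/eqP.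
  have rV : r x w^-1.
    rewrite /r -[w^-1 - 1]opprK sqrrN opprB.
    rewrite -(inj_eq (mulIf (expf_neq0 2 w0))).
    by rewrite -exprMn mulrBl mul1r mulVf // rw expr2 -!mulrA mulKf // mulrA.
  rewrite sum1_card; apply: (@leq_trans #|[set w; w^-1]|).
    by rewrite cards2 wV.
  apply/subset_leq_card/subsetP => v; rewrite !inE.
  by case/orP => /eqP->; rewrite unfold_in /= ?wW ?wVW // /r rw eqxx.
rewrite (exchange_big_dep (mem W)) /= => [|x w _ /andP[]//].
apply: leq_sum => w wW; rewrite sum1dep_card.
apply: (@fibre w) => [|x]; first by apply: contraNneq W0 => <-.
by rewrite inE => /and3P[].
Qed.

(** Over a period k both a ^ k and b ^ k are 1, so (-1) ^ k = (a b) ^ k = 1. *)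
Lemma fib_period_even (p : nat) (K : fieldType) (iota : {rmorphism 'F_p -> K})
    (a : K) k : a ^+ 2 = a + 1 -> 5%:R != 0 :> K -> 2%:R != 0 :> K ->
  fib_period p k -> ~~ odd k.
Proof.
move=> a2 n5 n2 per; have ab0 := golden_sub_neq0 a2 n5.
have [ak bk] := fib_period_golden iota a2 ab0 per.
have : (a * (1 - a)) ^+ k = 1 by rewrite exprMn ak bk mulr1.
rewrite golden_mul_conj // -signr_odd; case: odd => // /eqP.
rewrite -[nat_of_bool true]/1%N expr1 eq_sym -subr_eq0 opprK.
by rewrite -(natrD _ 1 1) (negPf n2).
Qed.

(** * Fibonacci residues in a subgroup *)

Definition fib_residues_parity (p : nat) (e : bool) : {set 'F_p} :=
  [set x | `[< exists n, odd n = e /\ fibp p n = x >]].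

(** As 2h is a period, w = (- a ^ 2) ^ n has w ^ h = ((-1) ^ n) ^ h, which
    depends only on the parity of n: the residues of one parity are all covered
    by the solutions W of a single pair of equations. *)
Lemma fib_parity_bound (p : nat) (G : {group {unit 'F_p}}) h e A B C M :
  prime p -> (5 < p)%N -> fib_period p (2 * h) ->
  (A <= h)%N -> (A * B <= 2 * #|G|)%N -> (A + h * B.-1 <= p)%N -> (M <= p)%N ->
  (\sum_(m < M) (A + m) < A * B * C)%N ->
  (M * #|fib_residues_parity p e :&: [set FinRing.uval u | u in G]| <=
   A.-1 + h * B.-1 + 2 * #|G| * C.-1 + 2 * M)%N.
Proof.
move=> pp p5 per Ah AB AhB Mp count.
have [K [iota [a a2]]] := golden_field 'F_p.
have pK : p \in [pchar K] by apply: (rmorph_pchar iota); apply: pchar_Fp.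
have n5 : 5%:R != 0 :> K.
  by rewrite -(dvdn_pcharf pK); apply/negP => /dvdn_leq; lia.
have ab0 := golden_sub_neq0 a2 n5.
have [ah _] := fib_period_golden iota a2 ab0 per.
have a0 : a != 0.
  apply/eqP => a00; move/eqP: a2.
  by rewrite a00 expr0n add0r eq_sym oner_eq0.
pose c : K := 5%:R * (-1) ^+ e.
have c0 : c != 0 by rewrite mulf_neq0 // signr_eq0.
pose W := [set w : K | [&& w != 0, w != 1, w ^+ h == ((-1) ^+ e) ^+ h &
                          (w - 1) ^+ (2 * #|G|) == c ^+ #|G| * w ^+ #|G|]].
apply: (@leq_trans (M * (#|W| + 2))).
  rewrite leq_mul2l; apply/orP; right.
  apply: (card_le_curve (iota := iota) c0); rewrite ?inE ?eqxx ?andbF //.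
  move=> x; rewrite !inE => /andP[/asboolP[n [ne <-]] /imsetP[u uG fu]].
  pose w := (- a ^+ 2) ^+ n.
  have w0 : w != 0 by rewrite expf_neq0 // oppr_eq0 expf_neq0.
  have cur : (w - 1) ^+ 2 = c * iota (fibp p n) ^+ 2 * w.
    by rewrite /c -ne signr_odd; apply: fib_golden_curve.
  have f0 : fibp p n != 0.
    by rewrite fu; have := valP u; rewrite unitfE.
  have fG : iota (fibp p n) ^+ #|G| = 1.
    by rewrite fu -rmorphXn -FinRing.val_unitX expg_cardG // rmorph1.
  have w1 : w != 1.
    apply: contra_eq_neq cur => ->; rewrite subrr expr0n mulr1 eq_sym.
    by rewrite mulf_neq0 // expf_neq0 // fmorph_eq0.
  have wh : w ^+ h = ((-1) ^+ e) ^+ h.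
    rewrite /w [X in X ^+ h]exprNn exprMn -ne signr_odd -!exprM.
    rewrite (mulnC n) mulnA.
    by rewrite [X in _ * X]exprM ah expr1n mulr1.
  have wG : (w - 1) ^+ (2 * #|G|) = c ^+ #|G| * w ^+ #|G|.
    by rewrite exprM cur 2!exprMn exprAC fG expr1n mulr1.
  exists w; split; rewrite ?inE ?w0 ?w1 ?wh ?wG ?eqxx //.
  rewrite invr_eq0 w0 invr_eq1 w1 exprVn wh -exprVn invr_sign eqxx /=.
  have -> : w^-1 - 1 = - (w - 1) * w^-1.
    by rewrite mulNr mulrBl mul1r divff // opprB.
  rewrite exprMn exprM sqrrN -exprM wG exprVn mul2n -addnn exprD invfM.
  by rewrite mulrA (mulfK (expf_neq0 _ w0)) exprVn.
rewrite mulnDr [(M * 2)%N]mulnC leq_add2r cardE.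
apply: (stepanov_bound pK Ah AB AhB Mp count (enum_uniq W)) => w.
rewrite mem_enum inE => /and4P[w0 w1 /eqP wh /eqP wG].
by split=> //; [exact: wh | exact: wG].
Qed.

Lemma pisano_period p : fib_period p (pisano p).
Proof. by rewrite /pisano; case: ex_minnP. Qed.

Lemma card_fib_residues p : (#|fib_residues p| <= pisano p)%N.
Proof.
have /andP[P0 /asboolP per] := pisano_period p.
have perM n q : fibp p (n + q * pisano p) = fibp p n.
  by elim: q => [|q IH]; rewrite ?addn0 // mulSn addnCA addnC per.
rewrite -[leqRHS]card_ord.
apply: leq_trans (leq_imset_card (fun i : 'I_(pisano p) => fibp p i) predT).
apply/subset_leq_card/subsetP => x; rewrite inE => /asboolP[n <-].
apply/imsetP; exists (Ordinal (ltn_pmod n P0)) => //=.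
by rewrite {1}(divn_eq n (pisano p)) addnC perM.
Qed.

(** The bound with cube roots and denominators cleared. *)
Theorem card_fib_subgroup_bound (p : nat) (G : {group {unit 'F_p}})
    (N := #|fib_residues p :&: [set FinRing.uval u | u in G]|) : prime p ->
  (N ^ 3 < 432 * (pisano p * #|G|))%N || (N * p < 12 * (pisano p * #|G|))%N.
Proof.
move=> pp; rewrite !ltnNge -negb_and; apply/negP => /andP[cube lin].
have NP : (N <= pisano p)%N.
  exact: leq_trans (subset_leq_card (subsetIl _ _)) (card_fib_residues p).
have NG : (N <= #|G|)%N.
  exact: leq_trans (subset_leq_card (subsetIr _ _)) (leq_imset_card _ _).
have P0 : (0 < pisano p)%N by case/andP: (pisano_period p).
have [N432 Np] := large_of_cube_bound (cardG_gt0 G) P0 NG NP cube lin.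
have p5 : (5 < p)%N by lia.
have [h Ph] : exists h, pisano p = (2 * h)%N.
  have [K [iota [a a2]]] := golden_field 'F_p.
  have pK : p \in [pchar K] by apply: (rmorph_pchar iota); apply: pchar_Fp.
  have := @fib_period_even p K iota a (pisano p) a2.
  rewrite -!(dvdn_pcharf pK) !gtnNdvd //; last by lia.
  move=> /(_ isT isT (pisano_period p)) ev.
  by exists (pisano p)./2; rewrite mul2n even_halfK.
have per := pisano_period p.
rewrite Ph in NP cube lin per.
have [||A [B [C [M [Ah AB AhB Mp [count small]]]]]] :=
  stepanov_parameters N432 Np NP NG; [by lia | by lia |].
pose X e := fib_residues_parity p e :&: [set FinRing.uval u | u in G].
have bnd e : (M * #|X e| <= _)%N :=
  fib_parity_bound e pp p5 per Ah AB AhB Mp count.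
have : (N <= #|X false| + #|X true|)%N.
  apply: leq_trans (leq_card_setU _ _).
  apply/subset_leq_card/subsetP => x.
  rewrite -setIUl !inE => /andP[/asboolP[n <-] ->]; rewrite andbT.
  by apply/orP; case on: (odd n); [right | left]; apply/asboolP; exists n.
move=> le; have := leq_mul (leqnn M) le.
have bF := bnd false; have bT := bnd true.
by rewrite mulnDr; lia.
Qed.

Theorem corollary2 (R : realType) (p : nat) (hp : prime p)
    (G : {group {unit 'F_p}}) :
  (#|fib_residues p :&: [set FinRing.uval u | u in G]|%:R : R)
  < Num.max (6 * (2 : R) `^ 3^-1 * (pisano p)%:R `^ 3^-1 * #|G|%:R `^ 3^-1)
            (12 / p%:R * (pisano p)%:R * #|G|%:R).
Proof.
set N := #|_|; rewrite ltNge; apply/negP; rewrite ge_max => /andP[le1 le2].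
have cube (x : R) : 0 <= x -> (x `^ 3^-1) ^+ 3 = x.
  move=> x0; rewrite -powR_mulrn ?powR_ge0 // -powRrM.
  by rewrite mulVf ?pnatr_eq0 // powRr1.
have := card_fib_subgroup_bound G hp; rewrite !ltnNge -negb_and.
apply/negP/negPn/andP; rewrite -/N; split; rewrite -(ler_nat R).
  have := lerXn2r 3 _ _ le1; rewrite !nnegrE ?mulr_ge0 ?powR_ge0 ?ler0n //.
  move=> /(_ isT isT); rewrite !exprMn !cube ?ler0n // -[N%:R ^+ 3]natrX.
  apply: le_trans.
  by rewrite !natrM; lra.
have p0 : 0 < p%:R :> R by rewrite ltr0n prime_gt0.
rewrite -(ler_pM2r p0) in le2; rewrite !natrM; move: le2. apply: le_trans.
by rewrite le_eqVlt; apply/orP; left; apply/eqP; field; rewrite gt_eqF.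
Qed.
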